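(* Let $d\ge 1$ and let $E\subset\mathbb{R}^d$ be a set with Hausdorff dimension $\dim_H E\le d-1$. Then $E$ is thin for isotropic doubling measures on $\mathbb{R}^d$, i.e. $\mu(E)=0$ for every isotropic doubling measure $\mu$ on $\mathbb{R}^d$.
   Context: A rectangular box in $\mathbb{R}^d$ is an isometric image (arbitrary orientation allowed) of a product $\prod_{i=1}^d[0,\ell_i]$ with all $\ell_i>0$. A Borel measure $\mu$ on $\mathbb{R}^d$ is isotropic doubling if there is a constant $A\ge 1$ such that $A^{-1}\le \mu(R_1)/\mu(R_2)\le A$ whenever $R_1$ and $R_2$ are congruent rectangular boxes with nonempty intersection; it is understood that $0<\mu(R)<\infty$ for every rectangular box $R$. For a set $E$ that is not assumed Borel, $\mu(E)$ is the value of the associated (Borel regular) outer measure. *)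

(* Defs.v *)
From HB Require Import structures.
From mathcomp Require Import all_boot all_order all_algebra.
From mathcomp Require Import all_classical all_reals all_analysis.
Set Implicit Arguments.
Unset Strict Implicit.
Unset Printing Implicit Defensive.
Import Order.TTheory GRing.Theory Num.Theory.
Import numFieldNormedType.Exports.
Local Open Scope classical_set_scope.
Local Open Scope ring_scope.

(* The library norm on 'rV[R]_d is the sup norm. It induces the usual topology,
   but isometries and diameters below refer to the Euclidean distance. *)
Definition eucl_dist (R : realType) (d : nat) (x y : 'rV[R]_d) : R :=
  Num.sqrt (\sum_(i < d) (x ord0 i - y ord0 i) ^+ 2).

Definition eucl_isometry (R : realType) (d : nat)
    (f : 'rV[R]_d -> 'rV[R]_d) : Prop :=
  forall x y, eucl_dist (f x) (f y) = eucl_dist x y.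

Definition congruent (R : realType) (d : nat) (A B : set 'rV[R]_d) : Prop :=
  exists f : 'rV[R]_d -> 'rV[R]_d, eucl_isometry f /\ f @` A = B.

Definition rectangular_box (R : realType) (d : nat) (B : set 'rV[R]_d) : Prop :=
  exists l : 'I_d -> R, (forall i, 0 < l i) /\
    congruent [set x : 'rV[R]_d | forall i, 0 <= x ord0 i <= l i] B.

(* R^d with its Borel sigma-algebra. *)
Notation borel_rV R d := (g_sigma_algebraType (@open 'rV[R]_d)).

Definition isotropic_doubling (R : realType) (d : nat)
    (mu : {measure set (borel_rV R d) -> \bar R}) : Prop :=
  (forall B : set 'rV[R]_d, rectangular_box B -> (0 < mu B < +oo)%E) /\
  exists A : R, 1 <= A /\
    forall R1 R2 : set 'rV[R]_d,
      rectangular_box R1 -> rectangular_box R2 -> congruent R1 R2 ->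
      R1 `&` R2 !=set0 ->
      ((A^-1)%:E <= mu R1 / mu R2 <= A%:E)%E.

(* Only meaningful for nonempty sets: diam set0 = -oo. *)
Definition diam (R : realType) (d : nat) (U : set 'rV[R]_d) : \bar R :=
  ereal_sup [set (eucl_dist p.1 p.2)%:E | p in U `*` U].

(* The empty set has gauge 0 and a nonempty set has gauge 1 when s = 0,
   so that the 0-dimensional Hausdorff measure is the counting measure. *)
Definition hausdorff_gauge (R : realType) (d : nat) (s : R)
    (U : set 'rV[R]_d) : \bar R :=
  if U == set0 then 0%E else (diam U `^ s)%E.

Definition hausdorff_premeasure (R : realType) (d : nat) (s delta : R)
    (E : set 'rV[R]_d) : \bar R :=
  ereal_inf [set (\sum_(k <oo) hausdorff_gauge s (U k))%E |
    U in [set U : nat -> set 'rV[R]_d |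
      (forall k, (diam (U k) <= delta%:E)%E) /\ E `<=` \bigcup_k U k]].

Definition hausdorff_measure (R : realType) (d : nat) (s : R)
    (E : set 'rV[R]_d) : \bar R :=
  ereal_sup [set hausdorff_premeasure s delta E | delta in [set e : R | 0 < e]].

Definition hausdorff_dim (R : realType) (d : nat) (E : set 'rV[R]_d) : \bar R :=
  ereal_inf [set s%:E | s in [set s : R | 0 <= s /\ hausdorff_measure s E = 0%E]].

(* E is not assumed Borel, hence the outer measure mu^* (infimum of the total
   mass over countable covers by Borel sets). *)
Definition thin_isotropic_doubling (R : realType) (d : nat)
    (E : set 'rV[R]_d) : Prop :=
  forall mu : {measure set (borel_rV R d) -> \bar R},
    isotropic_doubling mu -> (mu^*)%mu E = 0%E.

(* Main.v *)
Require Import Defs.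
From mathcomp Require Import all_boot all_order all_algebra.
From mathcomp Require Import all_classical all_reals all_analysis.
From mathcomp Require Import ring lra.
Set Implicit Arguments.
Unset Strict Implicit.
Unset Printing Implicit Defensive.
Import Order.TTheory GRing.Theory Num.Theory.
Import numFieldNormedType.Exports.
Local Open Scope classical_set_scope.
Local Open Scope ring_scope.

(** Write d = n + 1 and let A be the constant of an isotropic doubling measure
    mu. The theorem follows from the local estimate that a set of small
    diameter r in a bounded region has mass at most C * r ^ (n + alpha), where
    C depends on the region and alpha > 0 only on A: a set of dimension at most
    n is null for the s-dimensional Hausdorff measure for some s < n + alpha, so
    it has covers with arbitrarily small sums of r ^ s, hence of masses.

    The exponent n comes from rotating tubes. Consider the tubes of length 3
    and width of order 1/N that issue from a point x. One can choose N ^ n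
    directions so that the end pieces of length 1, at distance at least 2 from
    x, are pairwise disjoint ([fan_tubes_disjoint]). All of them lie in one cube,
    and each is reached from any piece of length 1 at x by a chain of three
    congruent boxes that meet. So a tube of length 1 and width 1/N has mass
    O(N ^ -n) ([mass_tube_girth]). The gain alpha comes from shortening a tube:
    when a box is cut in three along its length, the two outer thirds have
    comparable masses, so each carries at most the fraction
    1 / (1 + A ^ -2) of the mass ([mass_third]). Iterating k times brings
    a tube of width of order 3 ^ -k to length 3 ^ -k, and such a box contains a
    prescribed set of diameter of order 3 ^ -k ([mu_ext_le_pow]). Comparing
    powers of 3 with powers of the diameter gives [mu_ext_le_gauge], with any
    exponent s such that 3 ^ s <= 3 ^ n * (1 + A ^ -2).

    The rotations are replaced by Householder reflections: a reflection takes
    the first axis to any direction, is its own inverse, and needs no choice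
    of an orthonormal frame. The reflection in the zero vector is the identity,
    so boxes parallel to the axes are the case w = 0. *)

(** * Reflections and Euclidean isometries *)

Definition dot {R : realType} {d : nat} (x y : 'rV[R]_d) : R :=
  \sum_(i < d) x ord0 i * y ord0 i.

(** The reflection in the hyperplane orthogonal to w. For w = 0 the quotient is
    0 / 0 = 0 and the map is the identity ([refl0l]). *)
Definition refl {R : realType} {d : nat} (w z : 'rV[R]_d) : 'rV[R]_d :=
  z - (2 * dot z w / dot w w) *: w.

Lemma dotZr (R : realType) (d : nat) (k : R) (x y : 'rV[R]_d) :
  dot x (k *: y) = k * dot x y.
Proof. by rewrite /dot mulr_sumr; apply: eq_bigr => i _; rewrite mxE; ring. Qed.

Lemma dotBl (R : realType) (d : nat) (x y z : 'rV[R]_d) :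
  dot (x - y) z = dot x z - dot y z.
Proof. by rewrite /dot -sumrB; apply: eq_bigr => i _; rewrite !mxE; ring. Qed.

Lemma dotC (R : realType) (d : nat) (x y : 'rV[R]_d) : dot x y = dot y x.
Proof. by apply: eq_bigr => i _; rewrite mulrC. Qed.

Lemma dot_eq0 (R : realType) (d : nat) (w : 'rV[R]_d) : dot w w = 0 -> w = 0.
Proof.
move=> w0; apply/rowP => i; rewrite mxE.
have /eqP := w0; rewrite psumr_eq0 => [/allP /(_ i)|j _]; last by rewrite -expr2 sqr_ge0.
by rewrite mem_index_enum => /(_ isT); rewrite mulf_eq0 orbb => /eqP.
Qed.

Lemma dot_reflr (R : realType) (d : nat) (w z : 'rV[R]_d) :
  dot (refl w z) w = - dot z w.
Proof.
rewrite /refl dotBl (dotC (_ *: w)) dotZr.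
have [/dot_eq0 -> |w0] := eqVneq (dot w w) 0.
  by rewrite /dot !big1 ?mulr0 ?subr0 ?oppr0 // => i _; rewrite mxE mulr0.
by field.
Qed.

Lemma reflK (R : realType) (d : nat) (w : 'rV[R]_d) : involutive (refl w).
Proof.
move=> z; rewrite /refl -/(refl w z) dot_reflr mulrN mulNr scaleNr opprK.
by rewrite /refl subrK.
Qed.

Lemma reflB (R : realType) (d : nat) (w y z : 'rV[R]_d) :
  refl w (y - z) = refl w y - refl w z.
Proof.
rewrite /refl dotBl mulrBr mulrBl scalerBl.
by apply/rowP => i; rewrite !mxE; ring.
Qed.

Lemma refl0 (R : realType) (d : nat) (w : 'rV[R]_d) : refl w 0 = 0.
Proof. by have := reflB w 0 0; rewrite !subrr. Qed.

Lemma refl0l (R : realType) (d : nat) (z : 'rV[R]_d) : refl 0 z = z.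
Proof. by rewrite /refl scaler0 subr0. Qed.

Lemma dot_refl (R : realType) (d : nat) (w z : 'rV[R]_d) :
  dot (refl w z) (refl w z) = dot z z.
Proof.
have h y : dot (refl w z) y = dot z y - 2 * dot z w / dot w w * dot y w.
  by rewrite /refl dotBl (dotC (_ *: w)) dotZr.
by rewrite h dot_reflr (dotC z) h; ring.
Qed.

Lemma eucl_distE (R : realType) (d : nat) (x y : 'rV[R]_d) :
  eucl_dist x y = Num.sqrt (dot (x - y) (x - y)).
Proof. by congr Num.sqrt; apply: eq_bigr => i _; rewrite !mxE expr2. Qed.

Lemma refl_isometry (R : realType) (d : nat) (w : 'rV[R]_d) :
  eucl_isometry (refl w).
Proof. by move=> x y; rewrite !eucl_distE -reflB dot_refl. Qed.

Lemma translation_isometry (R : realType) (d : nat) (v : 'rV[R]_d) :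
  eucl_isometry (fun z => z + v).
Proof. by move=> x y; rewrite !eucl_distE opprD addrACA subrr addr0. Qed.

Lemma coord_dist (R : realType) (d : nat) (x y : 'rV[R]_d) (i : 'I_d) :
  `|x ord0 i - y ord0 i| <= eucl_dist x y.
Proof.
rewrite -sqrtr_sqr ler_wsqrtr // (bigD1 i) //= lerDl.
by apply: sumr_ge0 => j _; rewrite sqr_ge0.
Qed.

Lemma continuous_dotl (R : realType) (d : nat) (w : 'rV[R]_d) :
  continuous (fun z : 'rV[R]_d => dot z w).
Proof.
apply: (@continuous_big R 'I_d +%R) => [x|i _ z]; first exact: add_continuous.
apply: (@continuousM R 'rV[R]_d (fun z => z ord0 i) (fun=> w ord0 i)).
  exact: coord_continuous.
exact: cst_continuous.
Qed.

Lemma continuous_refl_coord (R : realType) (d : nat) (x w : 'rV[R]_d) (i : 'I_d) :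
  continuous (fun z : 'rV[R]_d => refl w (z - x) ord0 i).
Proof.
have -> : (fun z : 'rV[R]_d => refl w (z - x) ord0 i) =
    fun z => z ord0 i + (-1) * x ord0 i - (dot z w - dot x w) * (2 * w ord0 i / dot w w).
  by apply/funext => z; rewrite /refl dotBl !mxE; ring.
move=> z.
apply: (@continuousB R R 'rV[R]_d (fun z => z ord0 i + -1 * x ord0 i)
  (fun z => (dot z w - dot x w) * (2 * w ord0 i / dot w w))).
  apply: (@continuousD R R 'rV[R]_d (fun z => z ord0 i) (fun=> -1 * x ord0 i)).
    exact: coord_continuous.
  exact: cst_continuous.
apply: (@continuousM R 'rV[R]_d (fun z => dot z w - dot x w)
  (fun=> 2 * w ord0 i / dot w w)); last exact: cst_continuous.
apply: (@continuousB R R 'rV[R]_d (fun z => dot z w) (fun=> dot x w)).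
  exact: continuous_dotl.
exact: cst_continuous.
Qed.

(** * Tubes *)

(** A box seen in the coordinates p centred at x and reflected by w: it occupies
    [a, a + L] along the axis and [0, c] in the n transverse directions. Keeping the
    starting abscissa a separate from x makes the consecutive pieces of one long
    tube differ only by a. *)
Definition tube {R : realType} {n : nat} (x w : 'rV[R]_n.+1) (a L c : R) :
    set 'rV[R]_n.+1 :=
  [set z | let p := refl w (z - x) in
    a <= p ord0 ord0 <= a + L /\ forall i, 0 <= p ord0 (lift ord0 i) <= c].

(** The isometry that carries the box [0, L] * [0, c] ^ n onto a tube. Its value at 0
    is the point at abscissa a on the axis of the tube. *)
Definition tube_frame {R : realType} {n : nat} (x w : 'rV[R]_n.+1) (a : R)
    (z : 'rV[R]_n.+1) : 'rV[R]_n.+1 :=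
  refl w (z + a *: delta_mx ord0 ord0) + x.

Lemma tube_frame_isometry (R : realType) (n : nat) (x w : 'rV[R]_n.+1) (a : R) :
  eucl_isometry (tube_frame x w a).
Proof.
move=> y z; rewrite /tube_frame translation_isometry refl_isometry.
by rewrite translation_isometry.
Qed.

Lemma tube_image (R : realType) (n : nat) (x w : 'rV[R]_n.+1) (a L c : R) :
  tube_frame x w a @` [set y : 'rV[R]_n.+1 |
    forall i, 0 <= y ord0 i <= if i == ord0 then L else c] = tube x w a L c.
Proof.
apply/seteqP; split => [_ /= [y hy <-]|z /= [h0 hl]].
  rewrite /tube /tube_frame /= addrK reflK; split.
    by rewrite !mxE /= mulr1; have := hy ord0; rewrite eqxx; lra.
  by move=> i; have := hy (lift ord0 i); rewrite !mxE /= mulr0 addr0.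
exists (refl w (z - x) - a *: delta_mx ord0 ord0).
  move=> i; case: (unliftP ord0 i) => [j ->|->] /=.
    by have := hl j; rewrite [in X in X -> _]/refl !mxE /= mulr0 subr0 => ->.
  by move: h0; rewrite /refl !mxE /= mulr1; lra.
by rewrite /tube_frame subrK reflK subrK.
Qed.

Lemma tube_rectangular_box (R : realType) (n : nat) (x w : 'rV[R]_n.+1) (a L c : R) :
  0 < L -> 0 < c -> rectangular_box (tube x w a L c).
Proof.
move=> L0 c0; exists (fun i => if i == ord0 then L else c); split.
  by move=> i; case: ifP.
exists (tube_frame x w a); split; [exact: tube_frame_isometry|exact: tube_image].
Qed.

(** An image of a box under one isometry is carried to its image under another by
    undoing the first; the frame of a tube has an explicit inverse. *)
Lemma tube_congruent (R : realType) (n : nat) (x w x' w' : 'rV[R]_n.+1)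
    (a a' L c : R) : congruent (tube x w a L c) (tube x' w' a' L c).
Proof.
pose g z := refl w (z - x) - a *: delta_mx ord0 ord0.
have gK y : g (tube_frame x w a y) = y by rewrite /g /tube_frame addrK reflK addrK.
exists (tube_frame x' w' a' \o g); split.
  move=> y z /=; rewrite tube_frame_isometry /g translation_isometry.
  by rewrite refl_isometry translation_isometry.
rewrite -!tube_image image_comp; congr image.
by apply/funext => y /=; rewrite gK.
Qed.

Lemma tube_measurable (R : realType) (n : nat) (x w : 'rV[R]_n.+1) (a L c : R) :
  measurable (tube x w a L c : set (borel_rV R n.+1)).
Proof.
have cl : closed (tube x w a L c).
  have -> : tube x w a L c =
      ((fun z => refl w (z - x) ord0 ord0) @^-1` [set t | a <= t <= a + L]) `&`
      \bigcap_(i : 'I_n) ((fun z => refl w (z - x) ord0 (lift ord0 i)) @^-1`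
        [set t | 0 <= t <= c]).
    apply/seteqP; split => [z [h hl]|z [h hl]]; split => // i; first by move=> _; exact: hl.
    exact: hl.
  have clI (p q : R) (i : 'I_n.+1) :
      closed ((fun z : 'rV[R]_n.+1 => refl w (z - x) ord0 i) @^-1` [set t | p <= t <= q]).
    apply: preimage_closed; first by move=> z _; exact: continuous_refl_coord.
    by rewrite -set_itvcc; exact: interval_closed.
  by apply: closedI; [exact: clI|apply: closed_bigI => i _; exact: clI].
rewrite -(setCK (tube _ _ _ _ _)); apply: measurableC.
by apply: sub_sigma_algebra; exact: closed_openC.
Qed.

(** * Masses of tubes *)

(** The doubling condition for a fixed constant, as a one-sided inequality between
    extended reals; the symmetry of the hypotheses on R1 and R2 gives the other side. *)
Definition doubling_const (R : realType) (d : nat)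
    (mu : {measure set (borel_rV R d) -> \bar R}) (A : R) : Prop :=
  [/\ forall B : set 'rV[R]_d, rectangular_box B -> (0 < mu B < +oo)%E, 1 <= A &
    forall R1 R2 : set 'rV[R]_d,
      rectangular_box R1 -> rectangular_box R2 -> congruent R1 R2 ->
      R1 `&` R2 !=set0 -> (mu R1 <= A%:E * mu R2)%E].

Lemma isotropic_doubling_const (R : realType) (d : nat)
    (mu : {measure set (borel_rV R d) -> \bar R}) :
  isotropic_doubling mu -> exists A, doubling_const mu A.
Proof.
move=> [box [A [A1 dbl]]]; exists A; split=> // R1 R2 b1 b2 c12 i12.
have /andP[_] := dbl _ _ b1 b2 c12 i12.
have fin B : rectangular_box B -> mu B = (fine (mu B))%:E.
  by move=> /box /andP[p0 poo]; rewrite fineK // ge0_fin_numE // ltW.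
have /andP[+ _] := box _ b2.
rewrite (fin _ b1) (fin _ b2) lte_fin => q0.
by rewrite inver gt_eqF // -!EFinM !lee_fin ler_pdivrMr.
Qed.

(** Boxes have finite mass, so that their masses can be compared in R. *)
Definition mass (R : realType) (d : nat)
    (mu : {measure set (borel_rV R d) -> \bar R}) (B : set 'rV[R]_d) : R :=
  fine (mu B).

Lemma massE (R : realType) (d : nat)
    (mu : {measure set (borel_rV R d) -> \bar R}) (A : R) (B : set 'rV[R]_d) :
  doubling_const mu A -> rectangular_box B -> mu B = (mass mu B)%:E.
Proof.
move=> [box _ _] /box /andP[p0 poo]; rewrite /mass fineK //.
by rewrite ge0_fin_numE // ltW.
Qed.

Lemma mass_ge0 (R : realType) (d : nat)
    (mu : {measure set (borel_rV R d) -> \bar R}) (B : set 'rV[R]_d) : 0 <= mass mu B.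
Proof. by rewrite /mass fine_ge0. Qed.

Lemma tube_frame0 (R : realType) (n : nat) (x w : 'rV[R]_n.+1) (t a L c : R) :
  0 <= c -> a <= t <= a + L -> tube x w a L c (tube_frame x w t 0).
Proof.
move=> c0 ht; rewrite /tube /= /tube_frame addrK reflK add0r !mxE /= mulr1.
by split=> // i; rewrite !mxE /= mulr0 lexx.
Qed.

Lemma mass_tube_le (R : realType) (n : nat)
    (mu : {measure set (borel_rV R n.+1) -> \bar R}) (A : R)
    (x w x' w' : 'rV[R]_n.+1) (a a' L c : R) :
  doubling_const mu A -> 0 < L -> 0 < c ->
  tube x w a L c `&` tube x' w' a' L c !=set0 ->
  mass mu (tube x w a L c) <= A * mass mu (tube x' w' a' L c).
Proof.
move=> hA L0 c0 h.
have b1 := tube_rectangular_box x w a L0 c0.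
have b2 := tube_rectangular_box x' w' a' L0 c0.
have [_ _ /(_ _ _ b1 b2 (tube_congruent _ _ _ _ _ _ _ _) h)] := hA.
by rewrite (massE hA b1) (massE hA b2) -EFinM lee_fin.
Qed.

(** Consecutive pieces of a tube share the point of the axis where they abut. *)
Lemma mass_tube_next (R : realType) (n : nat)
    (mu : {measure set (borel_rV R n.+1) -> \bar R}) (A : R)
    (x w : 'rV[R]_n.+1) (a L c : R) :
  doubling_const mu A -> 0 < L -> 0 < c ->
  mass mu (tube x w a L c) <= A * mass mu (tube x w (a + L) L c).
Proof.
move=> hA L0 c0; apply: mass_tube_le => //.
by exists (tube_frame x w (a + L) 0); split; apply: tube_frame0; lra.
Qed.

Lemma doubling_const_gt0 (R : realType) (d : nat)
    (mu : {measure set (borel_rV R d) -> \bar R}) (A : R) :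
  doubling_const mu A -> 0 < A.
Proof. by move=> [_ A1 _]; exact: lt_le_trans A1. Qed.

Lemma sum_mass_le (R : realType) (d : nat)
    (mu : {measure set (borel_rV R d) -> \bar R}) (A : R) (J : finType)
    (F : J -> set 'rV[R]_d) (B : set 'rV[R]_d) :
  doubling_const mu A ->
  (forall j, rectangular_box (F j)) -> rectangular_box B ->
  (forall j, measurable (F j : set (borel_rV R d))) ->
  measurable (B : set (borel_rV R d)) ->
  (forall j, F j `<=` B) ->
  (forall j j', F j `&` F j' !=set0 -> j = j') ->
  \sum_j mass mu (F j) <= mass mu B.
Proof.
move=> hA bF bB mF mB FB dF.
rewrite -lee_fin -sumEFin -(massE hA bB).
under eq_bigr do rewrite -(massE hA (bF _)).
rewrite (reindex (@enum_val J predT)) /=; last first.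
  by apply: onW_bij; exact: enum_val_bij.
rewrite -(@measure_bigsetU_ord _ _ _ mu _ predT (fun i => F (enum_val i))) //; last first.
  by move=> i j _ _ /dF /enum_val_inj.
apply: le_measure; rewrite ?inE //; first exact: bigsetU_measurable.
by rewrite -bigcup_seq => z [i _] /FB.
Qed.

(** The first and last thirds are disjoint, and they are comparable through the middle
    third up to A ^ 2. Thirds are used instead of halves because the two halves share a
    face, whose measure is not known to vanish. *)
Lemma mass_third (R : realType) (n : nat)
    (mu : {measure set (borel_rV R n.+1) -> \bar R}) (A : R)
    (x w : 'rV[R]_n.+1) (a l c : R) :
  doubling_const mu A -> 0 < l -> 0 < c ->
  (1 + (A ^+ 2)^-1) * mass mu (tube x w a l c) <= mass mu (tube x w a (3 * l) c).
Proof.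
move=> hA l0 c0; have A0 := doubling_const_gt0 hA.
have h : mass mu (tube x w a l c) <= A ^+ 2 * mass mu (tube x w (a + l + l) l c).
  rewrite expr2 -mulrA; apply: (le_trans (mass_tube_next x w a hA l0 c0)).
  by rewrite ler_pM2l //; exact: mass_tube_next.
rewrite mulrDl mul1r.
pose F (b : bool) := if b then tube x w a l c else tube x w (a + l + l) l c.
have := @sum_mass_le R n.+1 mu A bool F (tube x w a (3 * l) c) hA.
rewrite big_bool /= => H; apply: le_trans (H _ _ _ _ _ _); last first.
- move=> j j'.
  have no z : tube x w a l c z -> tube x w (a + l + l) l c z -> False.
    by move=> [h1 _] [h2 _]; lra.
  by case: j; case: j' => //= -[z [h1 h2]]; case: (no z).
- by move=> [] z /= [h1 h2]; split => //; lra.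
- exact: tube_measurable.
- by case; exact: tube_measurable.
- by apply: tube_rectangular_box => //; rewrite mulr_gt0.
- by case; exact: tube_rectangular_box.
by rewrite lerD2l ler_pdivrMl // exprn_gt0.
Qed.

Lemma mass_pow3 (R : realType) (n : nat)
    (mu : {measure set (borel_rV R n.+1) -> \bar R}) (A : R)
    (x w : 'rV[R]_n.+1) (a c : R) (k : nat) :
  doubling_const mu A -> 0 < c ->
  (1 + (A ^+ 2)^-1) ^+ k * mass mu (tube x w a (3 ^- k) c) <= mass mu (tube x w a 1 c).
Proof.
move=> hA c0; elim: k => [|k IH]; first by rewrite expr0 invr1 mul1r.
apply: le_trans IH; have A0 := doubling_const_gt0 hA.
have -> : (3 ^- k : R) = 3 * 3 ^- k.+1 by rewrite exprSr; field; rewrite expf_neq0.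
rewrite exprSr -mulrA ler_pM2l; first by apply: mass_third => //; rewrite invr_gt0 exprn_gt0.
by rewrite exprn_gt0 // addr_gt0 // invr_gt0 exprn_gt0.
Qed.

(** * A fan of disjoint tubes *)

(** The reflection vectors (1, j / N), with j in a grid of N ^ n points. The
    reflection takes the first axis to the inverse stereographic projection of - j / N,
    so distinct j give directions that differ by at least a constant over N. *)
Definition fan {R : realType} {n N : nat} (j : {ffun 'I_n -> 'I_N}) : 'rV[R]_n.+1 :=
  \row_i oapp (fun k => (j k)%:R / N%:R) 1 (unlift ord0 i).

Lemma fan0 (R : realType) (n N : nat) (j : {ffun 'I_n -> 'I_N}) :
  fan j ord0 ord0 = 1 :> R.
Proof. by rewrite mxE unlift_none. Qed.

Lemma fan_lift (R : realType) (n N : nat) (j : {ffun 'I_n -> 'I_N}) (i : 'I_n) :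
  fan j ord0 (lift ord0 i) = (j i)%:R / N%:R :> R.
Proof. by rewrite mxE liftK. Qed.

Lemma fan_itv (R : realType) (n N : nat) (j : {ffun 'I_n -> 'I_N}) (i : 'I_n) :
  0 <= (fan j ord0 (lift ord0 i) : R) <= 1.
Proof.
have N0 : (0 < N%:R :> R) by rewrite ltr0n (leq_ltn_trans (leq0n _) (ltn_ord (j i))).
rewrite fan_lift divr_ge0 ?ler0n //= ler_pdivrMr // mul1r ler_nat.
exact: ltnW (ltn_ord _).
Qed.

(** The transverse width for which the grid of mesh 1 / N separates the tubes; the
    factor (n + 1) ^ 2 is what the estimate in [fan_tubes_disjoint] requires. *)
Definition girth {R : realType} (n N : nat) : R := (N%:R * n.+1%:R ^+ 2)^-1.

Lemma girth_gt0 (R : realType) (n N : nat) : (0 < N)%N -> 0 < girth n N :> R.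
Proof. by move=> N0; rewrite invr_gt0 mulr_gt0 ?exprn_gt0 ?ltr0n. Qed.

Lemma girth_le1 (R : realType) (n N : nat) : (0 < N)%N -> girth n N <= 1 :> R.
Proof.
move=> N0; rewrite invf_le1 ?mulr_gt0 ?exprn_gt0 ?ltr0n //.
by rewrite -natrX -natrM ler1n muln_gt0 N0 expn_gt0.
Qed.

Lemma dot_self_le (R : realType) (n : nat) (p : 'rV[R]_n.+1) (c : R) :
  (forall i, 0 <= p ord0 (lift ord0 i) <= c) ->
  p ord0 ord0 ^+ 2 <= dot p p <= p ord0 ord0 ^+ 2 + n%:R * c ^+ 2.
Proof.
move=> hp; rewrite /dot big_ord_recl -expr2 lerDl lerD2l; apply/andP; split.
  by apply: sumr_ge0 => i _; rewrite -expr2 sqr_ge0.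
have -> : n%:R * c ^+ 2 = \sum_(i < n) c ^+ 2 by rewrite sumr_const card_ord mulr_natl.
apply: ler_sum => i _.
by have := hp i; nra.
Qed.

(** Since y - p is parallel to the reflection vector, whose first coordinate is 1,
    the increment of the first coordinate determines the others. The
    increment is bounded away from 0 because the reflection changes the sign of the
    product with w, and p has a product at least 2 with w. *)
Lemma fan_slope (R : realType) (n N : nat) (j : {ffun 'I_n -> 'I_N})
    (p y : 'rV[R]_n.+1) :
  p = refl (fan j) y -> 2 <= p ord0 ord0 ->
  (forall i, 0 <= p ord0 (lift ord0 i)) ->
  (forall i, y ord0 i = p ord0 i + (y ord0 ord0 - p ord0 ord0) * fan j ord0 i) /\
  4 <= (p ord0 ord0 - y ord0 ord0) * n.+1%:R.
Proof.
move=> pE p2 p0; set w : 'rV[R]_n.+1 := fan j.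
set k := 2 * dot y w / dot w w.
have hp i : p ord0 i = y ord0 i - k * w ord0 i by rewrite pE !mxE.
have hk : k = y ord0 ord0 - p ord0 ord0 by rewrite hp fan0; ring.
split=> [i|]; first by rewrite -hk hp; ring.
have [ww1 wwn] : 1 <= dot w w /\ dot w w <= n.+1%:R.
  have := dot_self_le (fan_itv R j); rewrite -/w /w fan0 !expr1n mulr1 => /andP[h1 h2].
  by rewrite -natr1 addrC.
have pw : 2 <= dot p w.
  rewrite /dot big_ord_recl fan0 mulr1.
  suff : 0 <= \sum_(i < n) p ord0 (lift ord0 i) * w ord0 (lift ord0 i) by lra.
  by apply: sumr_ge0 => i _; rewrite mulr_ge0 //; have /andP[] := fan_itv R j i.
have kw : k * dot w w = - (2 * dot p w).
  by rewrite pE dot_reflr /k; field; rewrite gt_eqF // (lt_le_trans _ ww1).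
have -> : p ord0 ord0 - y ord0 ord0 = - k by rewrite hk opprB.
have k0 : k < 0 by rewrite -(pmulr_llt0 _ (lt_le_trans ltr01 ww1)) kw; lra.
nra.
Qed.

(** Suppose that x + y lies in two of the tubes, with coordinates p and p' in them.
    Then p and p' have the same norm as y, so their first coordinates almost agree, and
    [fan_slope] gives two expressions of the transverse coordinates of y. Since the slopes
    of distinct tubes differ by at least 1 / N in some coordinate, these cannot
    both hold. *)
Lemma fan_tubes_disjoint (R : realType) (n N : nat) (x : 'rV[R]_n.+1)
    (j j' : {ffun 'I_n -> 'I_N}) :
  tube x (fan j) 2 1 (girth n N) `&` tube x (fan j') 2 1 (girth n N) !=set0 ->
  j = j'.
Proof.
move=> [z [[]]]; set y := z - x.
set p := refl (fan j) y => h0 hl []; set p' := refl (fan j') y => h0' hl'.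
apply/ffunP => i; apply/val_inj => /=; apply/eqP/negP => /negP jj.
have N0 : (0 < N)%N by rewrite (leq_ltn_trans (leq0n _) (ltn_ord (j i))).
have NR : 0 < N%:R :> R by rewrite ltr0n.
have c0 := girth_gt0 R n N0; have c1 := girth_le1 R n N0.
have p2 : 2 <= p ord0 ord0 by case/andP: h0.
have p2' : 2 <= p' ord0 ord0 by case/andP: h0'.
have hl0 k : 0 <= p ord0 (lift ord0 k) by case/andP: (hl k).
have hl0' k : 0 <= p' ord0 (lift ord0 k) by case/andP: (hl' k).
have [yE k4] := @fan_slope R n N j p y erefl p2 hl0.
have [yE' _] := @fan_slope R n N j' p' y erefl p2' hl0'.
have /andP[D1 D2] := dot_self_le hl; have /andP[D1' D2'] := dot_self_le hl'.
rewrite !dot_refl in D1 D2 D1' D2'.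
set c := girth n N in c0 c1 D2 D2' hl hl'.
set T := p ord0 ord0 in p2 k4 yE D1 D2; set T' := p' ord0 ord0 in p2' yE' D1' D2'.
have TT : `|T' - T| <= n%:R * c.
  have n0 : 0 <= n%:R :> R by rewrite ler0n.
  have cc : c ^+ 2 <= c by nra.
  have ncc : n%:R * c ^+ 2 <= n%:R * c by rewrite ler_wpM2l.
  have := @subr_sqr R T' T.
  by rewrite ler_norml; nra.
have := yE (lift ord0 i); rewrite (yE' (lift ord0 i)) => yi.
set v := fan j ord0 (lift ord0 i) in yi; set v' := fan j' ord0 (lift ord0 i) in yi.
have /andP[v0 v1] : 0 <= v <= 1 := fan_itv R j i.
have /andP[v0' v1'] : 0 <= v' <= 1 := fan_itv R j' i.
(* Subtract the two expressions of the i-th coordinate of y. *)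
have kv : (T - y ord0 ord0) * `|v - v'| <= n.+1%:R * c.
  have k0 : 0 <= T - y ord0 ord0.
    by rewrite -(pmulr_lge0 _ (ltr0Sn R n)) (le_trans _ k4).
  rewrite -{1}(ger0_norm k0) -normrM.
  have -> : (T - y ord0 ord0) * (v - v') =
      (p ord0 (lift ord0 i) - p' ord0 (lift ord0 i)) + (T' - T) * v'.
    by move: yi; nra.
  apply: (le_trans (ler_normD _ _)).
  have -> : n.+1%:R * c = c + n%:R * c by rewrite -natr1; ring.
  apply: lerD; last first.
    by rewrite normrM (ger0_norm v0') (le_trans _ TT) // ler_piMr.
  by have := hl i; have := hl' i; rewrite ler_norml; lra.
have vv : N%:R^-1 <= `|v - v'|.
  rewrite /v /v' !fan_lift -mulrBl normrM (ger0_norm (x := N%:R^-1)) ?invr_ge0 ?ler0n //.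
  rewrite ler_peMl ?invr_ge0 ?ler0n //.
  case: (ltngtP (j i) (j' i)) jj => // lt _; [rewrite distrC|];
    by rewrite -natrB 1?ltnW // normr_nat ler1n subn_gt0.
have n1 : 0 < n.+1%:R :> R by rewrite ltr0Sn.
have h1 : 4 * N%:R^-1 <= (T - y ord0 ord0) * n.+1%:R * `|v - v'|.
  by apply: ler_pM => //; rewrite invr_ge0 ler0n.
have h2 : (T - y ord0 ord0) * n.+1%:R * `|v - v'| <= N%:R^-1.
  rewrite mulrAC (le_trans (ler_wpM2r (ltW n1) kv)) //.
  have -> // : n.+1%:R * c * n.+1%:R = N%:R^-1 :> R.
  by rewrite /c /girth; field; rewrite !gt_eqF.
have NV : 0 < N%:R^-1 :> R by rewrite invr_gt0.
by have := le_trans h1 h2; lra.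
Qed.

Lemma tube_sub_cube (R : realType) (n : nat) (M K c : R) (x w : 'rV[R]_n.+1) :
  0 <= c <= 1 -> (forall i, `|x ord0 i| <= M) -> M + n.+3%:R <= K ->
  tube x w 2 1 c `<=` tube (const_mx (- K)) 0 0 (2 * K) (2 * K).
Proof.
move=> /andP[c0 c1] xM hK z [h0 hl].
set p := refl w (z - x) in h0 hl.
have zK i : - K <= z ord0 i <= K.
  have zx : `|z ord0 i - x ord0 i| <= n.+3%:R.
    apply: (le_trans (coord_dist z x i)); rewrite eucl_distE -(dot_refl w) -/p.
    have /andP[_ pp] := dot_self_le hl.
    rewrite -(ger0_norm (ler0n R n.+3)) -sqrtr_sqr ler_wsqrtr //.
    apply: (le_trans pp).
    have -> : n.+3%:R = n%:R + 3 :> R by rewrite -addn3 natrD.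
    have n0 : 0 <= n%:R :> R by rewrite ler0n.
    have nc : n%:R * c ^+ 2 <= n%:R by rewrite ler_piMr // expr_le1.
    by nra.
  have := xM i; move: zx; rewrite !ler_norml; lra.
rewrite /tube /= refl0l; split=> [|i]; rewrite !mxE.
  by have := zK ord0; lra.
by have := zK (lift ord0 i); lra.
Qed.

(** The N ^ n end pieces are disjoint and lie in one cube, and the mass of a piece
    at x is at most A ^ 3 times that of each end piece: one step to turn the piece into
    the new direction about x, and two to slide it along the axis. *)
Lemma mass_tube_girth (R : realType) (n : nat)
    (mu : {measure set (borel_rV R n.+1) -> \bar R}) (A M : R) (N : nat)
    (x : 'rV[R]_n.+1) :
  doubling_const mu A -> (0 < N)%N -> (forall i, `|x ord0 i| <= M) ->
  N%:R ^+ n * mass mu (tube x 0 0 1 (girth n N)) <= A ^+ 3 *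
    mass mu (tube (const_mx (- (M + n.+3%:R))) 0 0 (2 * (M + n.+3%:R)) (2 * (M + n.+3%:R))).
Proof.
move=> hA N0 xM; have A0 := doubling_const_gt0 hA.
set K := M + n.+3%:R.
have c0 := girth_gt0 R n N0; have c1 := girth_le1 R n N0; set c := girth n N in c0 c1 *.
have K0 : 0 < 2 * K.
  rewrite mulr_gt0 // ltr_wpDl // (le_trans _ (xM ord0)) //.
pose F (j : {ffun 'I_n -> 'I_N}) := tube x (fan j) 2 1 c.
have step j : mass mu (tube x 0 0 1 c) <= A ^+ 3 * mass mu (F j).
  have h0 : mass mu (tube x 0 0 1 c) <= A * mass mu (tube x (fan j) 0 1 c).
    apply: mass_tube_le => //; exists x.
    by split; rewrite /tube /= subrr refl0 !mxE; split=> [|i]; rewrite ?mxE; lra.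
  have h1 := mass_tube_next x (fan j) 0 hA ltr01 c0.
  have h2 := mass_tube_next x (fan j) (0 + 1) hA ltr01 c0.
  have E : 0 + 1 + 1 = 2 :> R by ring.
  rewrite E -/(F j) in h2.
  rewrite !exprS expr0 mulr1 -!mulrA (le_trans h0) // ler_pM2l //.
  by rewrite (le_trans h1) // ler_pM2l.
have sumF : \sum_j mass mu (F j) <= mass mu (tube (const_mx (- K)) 0 0 (2 * K) (2 * K)).
  apply: (sum_mass_le hA).
  - by move=> j; exact: tube_rectangular_box.
  - exact: tube_rectangular_box.
  - by move=> j; exact: tube_measurable.
  - exact: tube_measurable.
  - by move=> j; apply: (tube_sub_cube _ xM) => //; rewrite (ltW c0).
  - exact: fan_tubes_disjoint.
have cardJ : N%:R ^+ n = #|{: {ffun 'I_n -> 'I_N}}|%:R :> R.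
  by rewrite card_ffun !card_ord natrX.
rewrite cardJ mulr_natl -sumr_const.
apply: (@le_trans _ _ (\sum_j A ^+ 3 * mass mu (F j))).
  by apply: ler_sum => j _; exact: step.
by rewrite -mulr_sumr ler_wpM2l // exprn_ge0 // ltW.
Qed.

(** * Masses of small sets *)

Lemma exprn_unbounded (R : realType) (b x : R) : 1 < b -> exists k, x < b ^+ k.
Proof.
move=> b1; have h0 : 0 < b - 1 by rewrite subr_gt0.
have bern k : 1 + k%:R * (b - 1) <= b ^+ k.
  elim: k => [|k IH]; first by rewrite mul0r addr0.
  have : 0 <= k%:R * (b - 1) ^+ 2 by rewrite mulr_ge0 ?sqr_ge0.
  have := ler_wpM2l (ltW (lt_trans ltr01 b1)) IH.
  by rewrite -exprS -natr1 expr2; lra.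
exists (Num.truncn (x / (b - 1))).+1; apply: lt_le_trans (bern _).
by rewrite ltr_wpDl // -ltr_pdivrMr // truncnS_gt.
Qed.

Lemma girth_expn (R : realType) (n k : nat) : girth n (3 ^ k)%N = girth n 1 * 3 ^- k :> R.
Proof. by rewrite /girth natrX mul1r invfM mulrC. Qed.

Lemma girth_le (R : realType) (n N : nat) : (0 < N)%N -> girth n N <= N%:R^-1 :> R.
Proof.
move=> N0; rewrite /girth invfM ger_pMr ?invr_gt0 ?ltr0n //.
by rewrite invf_le1 ?exprn_gt0 // exprn_ege1 // ler1n.
Qed.

Lemma eucl_dist_le_diam (R : realType) (d : nat) (U : set 'rV[R]_d) (x y : 'rV[R]_d) :
  U x -> U y -> ((eucl_dist x y)%:E <= diam U)%E.
Proof. by move=> Ux Uy; apply: ereal_sup_ubound; exists (x, y). Qed.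

(** At scale 3 ^ -k the set sits in a box of length 3 ^ -k and width girth n (3 ^ k).
    Such a box is obtained from a tube of length 1 by taking k times a third, and the
    mass of that tube is bounded by [mass_tube_girth] with N = 3 ^ k. The constant
    involves a cube that depends on M only, which makes the bound uniform over bounded
    sets. *)
Lemma mu_ext_le_pow (R : realType) (n : nat)
    (mu : {measure set (borel_rV R n.+1) -> \bar R}) (A M : R) :
  doubling_const mu A -> exists2 C : R, 0 <= C &
  forall (k : nat) (U V : set 'rV[R]_n.+1), V `<=` U ->
  (forall x, V x -> forall i, `|x ord0 i| <= M) ->
  (diam U <= (girth n 1 / 2 * 3 ^- k)%:E)%E ->
  ((mu^*)%mu V <= (C * (3 ^+ n * (1 + (A ^+ 2)^-1)) ^- k)%:E)%E.
Proof.
move=> hA.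
pose K := M + 1 + n.+3%:R.
pose C := A ^+ 3 * mass mu (tube (const_mx (- K)) 0 0 (2 * K) (2 * K)).
have A0 := doubling_const_gt0 hA.
have C0 : 0 <= C by rewrite mulr_ge0 ?mass_ge0 // exprn_ge0 // ltW.
have t0 : 0 < 1 + (A ^+ 2)^-1 by rewrite addr_gt0 // invr_gt0 exprn_gt0.
exists C => // k U V VU VM Uk.
have [->|/set0P[x0 Vx0]] := eqVneq V set0.
  rewrite mu_ext0 // lee_fin mulr_ge0 // invr_ge0 exprn_ge0 // mulr_ge0 ?exprn_ge0 //.
  exact: ltW.
have N0 : (0 < 3 ^ k)%N by rewrite expn_gt0.
have c0 := girth_gt0 R n N0; have c1 := girth_le1 R n N0; have ck := girth_le R n N0.
have cE := girth_expn R n k.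
set c := girth n (3 ^ k)%N in c0 c1 ck cE.
(* The box starts c / 2 below x0 in every coordinate, so that it contains the ball of
   radius c / 2 about x0. *)
pose x := x0 - const_mx (c / 2).
have xM i : `|x ord0 i| <= M + 1.
  by have := VM x0 Vx0 i; rewrite !mxE !ler_norml; lra.
have Vt : V `<=` tube x 0 0 (3 ^- k) c.
  move=> z Vz; rewrite /tube /= refl0l add0r.
  have zx i : `|z ord0 i - x0 ord0 i| <= c / 2.
    apply: (le_trans (coord_dist z x0 i)); rewrite -lee_fin.
    apply: (le_trans (eucl_dist_le_diam (VU z Vz) (VU x0 Vx0))).
    by apply: (le_trans Uk); rewrite lee_fin cE mulrAC.
  rewrite natrX in ck.
  split=> [|i]; rewrite !mxE.
    by have := zx ord0; rewrite ler_norml; lra.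
  by have := zx (lift ord0 i); rewrite ler_norml; lra.
have k0 : 0 < 3 ^- k :> R by rewrite invr_gt0 exprn_gt0.
apply: (le_trans (le_mu_ext mu Vt)).
rewrite measurable_mu_extE; last exact: tube_measurable.
rewrite (massE hA (tube_rectangular_box x 0 0 k0 c0)) lee_fin ler_pdivlMr; last first.
  by rewrite exprn_gt0 // mulr_gt0 // exprn_gt0.
have h1 := mass_pow3 x 0 0 k hA c0.
have h2 := mass_tube_girth hA N0 xM.
rewrite -/K -/C -/c natrX in h2.
rewrite exprMn mulrC -mulrA exprAC; apply: le_trans h2.
by rewrite ler_wpM2l // !exprn_ge0.
Qed.

(** A set of positive diameter is treated at the scale 3 ^ -k that matches its diameter up
    to a factor 3; at that scale the bound (3 ^ n * (1 + A ^ -2)) ^ -k is at most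
    (3 ^ -k) ^ s. A single point is contained in boxes of every scale and has measure 0. *)
Lemma mu_ext_le_gauge (R : realType) (n : nat)
    (mu : {measure set (borel_rV R n.+1) -> \bar R}) (A M s : R) :
  doubling_const mu A -> 0 <= s -> 3 `^ s <= 3 ^+ n * (1 + (A ^+ 2)^-1) ->
  exists2 C : R, 0 <= C & forall U V : set 'rV[R]_n.+1, V `<=` U ->
  (forall x, V x -> forall i, `|x ord0 i| <= M) ->
  (diam U <= (girth n 1 / 2)%:E)%E ->
  ((mu^*)%mu V <= C%:E * hausdorff_gauge s U)%E.
Proof.
move=> hA s0 hs; have [C C0 hC] := mu_ext_le_pow M hA.
set q := 3 ^+ n * (1 + (A ^+ 2)^-1) in hs hC.
have g0 : 0 < girth n 1 / 2 :> R by rewrite divr_gt0 // girth_gt0.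
set g := girth n 1 / 2 in g0 hC *.
exists (C * (3 / g) `^ s); first by rewrite mulr_ge0 // powR_ge0.
move=> U V VU VM Ug; rewrite /hausdorff_gauge.
have [U0|/set0P[x0 Ux0]] := eqVneq U set0.
  have -> : V = set0 by apply/seteqP; split=> // z /VU; rewrite U0.
  by rewrite mu_ext0 // mule0.
have d0 : (0 <= diam U)%E.
  apply: le_trans (eucl_dist_le_diam Ux0 Ux0).
  by rewrite lee_fin sqrtr_ge0.
have dfin : diam U \is a fin_num by rewrite ge0_fin_numE // (le_lt_trans Ug) // ltry.
have dE : diam U = (fine (diam U))%:E by rewrite fineK.
set r := fine (diam U) in dE; rewrite dE in d0 Ug *.
move: d0 Ug; rewrite !lee_fin => d0 Ug.
rewrite poweR_EFin -EFinM.
have A0 := doubling_const_gt0 hA.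
have q1 : 1 < q.
  rewrite /q.
  have t1 : 1 < 1 + (A ^+ 2)^-1 by rewrite ltrDl invr_gt0 exprn_gt0.
  by rewrite (lt_le_trans t1) // ler_peMl ?exprn_ege1 ?ler1n // ltW // (lt_trans _ t1).
have [r0|r0] := eqVneq r 0.
  have muV0 : ((mu^*)%mu V <= 0)%E.
    apply/lee_addgt0Pr => e e0; rewrite add0e.
    have [k hk] := exprn_unbounded (C / e) q1.
    apply: (le_trans (hC k U V VU VM _)).
      by rewrite dE r0 lee_fin mulr_ge0 ?(ltW g0) // invr_ge0 exprn_ge0.
    have qk : 0 < q ^+ k by rewrite exprn_gt0 // (lt_trans _ q1).
    by rewrite lee_fin ler_pdivrMr // mulrC -ler_pdivrMr // ltW.
  by apply: (le_trans muV0); rewrite lee_fin !mulr_ge0 // powR_ge0.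
have {}d0 : 0 < r by rewrite lt_neqAle eq_sym r0.
(* The scale is the last one, k, at which the diameter r is at most g * 3 ^ -k. *)
have ex : exists k, g * 3 ^- k < r.
  have [k hk] := @exprn_unbounded R 3 (g / r) ltac:(by rewrite ltr1n).
  exists k; rewrite ltr_pdivrMr ?exprn_gt0 // mulrC -ltr_pdivrMr //.
case: (ex_minnP ex) => -[|k] hk kmin; first by move: hk; rewrite expr0 invr1 mulr1 ltNge Ug.
have rk : r <= g * 3 ^- k by rewrite leNgt; apply/negP => /kmin; rewrite ltnn.
apply: (le_trans (hC k U V VU VM _)); first by rewrite dE lee_fin.
have g3 : 0 <= 3 / g by rewrite divr_ge0 // ltW.
rewrite lee_fin -mulrA ler_wpM2l // -powRM ?(ltW d0) //.
have rg : 3 ^- k <= 3 / g * r.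
  rewrite mulrAC ler_pdivlMr //; move: hk; rewrite exprS invfM => hk.
  by have : g * (3^-1 * 3 ^- k) = 3^-1 * (3 ^- k * g) :> R by [ring|]; lra.
apply: (@le_trans _ _ ((3 ^- k) `^ s)); last first.
  by rewrite ge0_ler_powR // ?nnegrE ?invr_ge0 ?exprn_ge0 // (le_trans _ rg) // invr_ge0 exprn_ge0.
have -> : (3 ^- k) `^ s = (3 `^ s) ^- k :> R.
  by rewrite -!powR_mulrn ?powR_ge0 // -!powRN -!powRrM; congr (_ `^ _); ring.
rewrite lef_pV2 ?posrE ?exprn_gt0 ?powR_gt0 // ?(lt_trans _ q1) //.
by apply: lerXn2r => //; rewrite nnegrE ?powR_ge0 // ltW // (lt_trans _ q1).
Qed.

(** * From covers to null sets *)

Lemma mu_ext_bigcup_null (R : realType) (d : nat)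
    (mu : {measure set (borel_rV R d) -> \bar R}) (F : nat -> set 'rV[R]_d) :
  (forall k, (mu^*)%mu (F k) = 0%E) -> (mu^*)%mu (\bigcup_k F k) = 0%E.
Proof.
move=> F0; apply/eqP; rewrite eq_le mu_ext_ge0 ?andbT //.
apply: (le_trans (@mu_ext_sigma_subadditive _ _ _ mu (measure_ge0 mu) F)).
by rewrite eseries0 // => k _ _; exact: F0.
Qed.

Lemma hausdorff_dim_lt (R : realType) (d : nat) (E : set 'rV[R]_d) (t : R) :
  (hausdorff_dim E < t%:E)%E ->
  exists s, [/\ 0 <= s, s < t & hausdorff_measure s E = 0%E].
Proof.
move=> /ereal_inf_lt[_ [s [s0 Es] <-]]; rewrite lte_fin => st.
by exists s.
Qed.

Lemma hausdorff_null_cover (R : realType) (d : nat) (E : set 'rV[R]_d) (s delta e : R) :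
  hausdorff_measure s E = 0%E -> 0 < delta -> 0 < e ->
  exists U : nat -> set 'rV[R]_d, [/\ forall k, (diam (U k) <= delta%:E)%E,
    E `<=` \bigcup_k U k & (\sum_(k <oo) hausdorff_gauge s (U k) < e%:E)%E].
Proof.
move=> E0 d0 e0.
have : (hausdorff_premeasure s delta E < e%:E)%E.
  apply: (@le_lt_trans _ _ 0%E); last by rewrite lte_fin.
  by rewrite -E0; apply: ereal_sup_ubound; exists delta.
by move=> /ereal_inf_lt[_ [U [dU EU] <-] lt]; exists U.
Qed.

Lemma hausdorff_gauge_ge0 (R : realType) (d : nat) (s : R) (U : set 'rV[R]_d) :
  (0 <= hausdorff_gauge s U)%E.
Proof. by rewrite /hausdorff_gauge; case: ifP => // _; exact: poweR_ge0. Qed.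

Lemma bounded_part_null (R : realType) (n : nat)
    (mu : {measure set (borel_rV R n.+1) -> \bar R}) (A M s : R) (E : set 'rV[R]_n.+1) :
  doubling_const mu A -> 0 <= s -> 3 `^ s <= 3 ^+ n * (1 + (A ^+ 2)^-1) ->
  hausdorff_measure s E = 0%E ->
  (mu^*)%mu (E `&` [set x | forall i, `|x ord0 i| <= M]) = 0%E.
Proof.
move=> hA s0 hs Es; have [C C0 hC] := mu_ext_le_gauge M hA s0 hs.
set B := [set x | _].
apply/eqP; rewrite eq_le mu_ext_ge0 ?andbT //; apply/lee_addgt0Pr => e e0; rewrite add0e.
have d0 : 0 < girth n 1 / 2 :> R by rewrite divr_gt0 // girth_gt0.
have e'0 : 0 < e / (C + 1) by rewrite divr_gt0 // ltr_wpDl.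
have [U [dU EU sU]] := hausdorff_null_cover Es d0 e'0.
apply: (@le_trans _ _ ((mu^*)%mu (\bigcup_k (U k `&` B)))).
  by apply: le_mu_ext; rewrite -setI_bigcupl; exact: setSI.
apply: (le_trans (@mu_ext_sigma_subadditive _ _ _ mu (measure_ge0 mu) _)).
apply: (@le_trans _ _ (\sum_(k <oo) (C%:E * hausdorff_gauge s (U k)))%E).
  apply: lee_nneseries => [k _ _|k _]; first exact: mu_ext_ge0.
  by apply: hC => // x [].
rewrite nneseriesZl => [|k _]; last exact: hausdorff_gauge_ge0.
apply: (le_trans (lee_wpmul2l _ (ltW sU))); first by rewrite lee_fin.
rewrite -EFinM lee_fin mulrCA ger_pMr // ler_pdivrMr ?mul1r ?lerDl //.
by rewrite ltr_wpDl.
Qed.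

Theorem proposition1p3 (R : realType) (d : nat) (hd : (1 <= d)%N)
    (E : set 'rV[R]_d) (hE : (hausdorff_dim E <= (d%:R - 1)%:E)%E) :
  thin_isotropic_doubling E.
Proof.
case: d hd E hE => // n _ E hE mu /isotropic_doubling_const[A hA].
have A0 := doubling_const_gt0 hA.
set t := 1 + (A ^+ 2)^-1.
have t1 : 1 < t by rewrite ltrDl invr_gt0 exprn_gt0.
have ln3 : 0 < ln 3 :> R by rewrite ln_gt0 // ltr1n.
have lnt : 0 < ln t by rewrite ln_gt0.
(* With t = 1 + A ^ -2, the exponent n + ln t / ln 3 solves 3 ^ s = 3 ^ n * t. *)
have [s [s0 st Es]] : exists s, [/\ 0 <= s, s < n%:R + ln t / ln 3 & hausdorff_measure s E = 0%E].
  apply: hausdorff_dim_lt; apply: (le_lt_trans hE).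
  by rewrite lte_fin -natr1 addrK ltrDl divr_gt0.
have hs : 3 `^ s <= 3 ^+ n * t.
  have -> : 3 ^+ n * t = 3 `^ (n%:R + ln t / ln 3).
    rewrite powRD ?pnatr_eq0 ?implybT // powR_mulrn //; congr (_ * _).
    rewrite /powR pnatr_eq0 /= divfK ?gt_eqF // lnK // posrE.
    exact: lt_trans t1.
  by rewrite ler_powR ?ler1n // ltW.
have -> : E = \bigcup_k (E `&` [set x | forall i, `|x ord0 i| <= k%:R]).
  rewrite -setI_bigcupr; apply/seteqP; split=> [x Ex|x []//]; split=> //.
  exists (Num.truncn (eucl_dist x 0)).+1 => // i /=.
  apply: (le_trans _ (ltW (truncnS_gt _))).
  by have := coord_dist x 0 i; rewrite mxE subr0.
by apply: mu_ext_bigcup_null => k; exact: (bounded_part_null k%:R hA s0 hs Es).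
Qed.
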